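(* For every integer $n \geq 2$, the abelianization $\mathcal{K}_n^{\mathrm{ab}}$ of the kernel $\mathcal{K}_n$ of the Magnus representation $r_M : \mathrm{IA}_n \to \mathrm{GL}(n,\mathbf{Z}[H])$ is not finitely generated.
   Context: $F_n$ is the free group of rank $n \geq 2$ with fixed basis $x_1,\dots,x_n$, and $H := F_n^{\mathrm{ab}}$ is its abelianization. For a group $G$, $G^{\mathrm{ab}}$ denotes its abelianization and $\mathbf{Z}[G]$ its integral group ring. $\mathrm{Aut}\,F_n$ acts on $F_n$ from the right: $x^{\sigma}$ is the image of $x$ under $\sigma$, and $x^{\sigma\tau}=(x^\sigma)^\tau$. $\mathrm{IA}_n$ is the kernel of the natural homomorphism $\mathrm{Aut}\,F_n \to \mathrm{Aut}\,H$. For $1\le i\le n$ the Fox derivation $\frac{\partial}{\partial x_i} : \mathbf{Z}[F_n]\to\mathbf{Z}[F_n]$ is the additive map defined on a reduced word $w=x_{\mu_1}^{\epsilon_1}\cdots x_{\mu_r}^{\epsilon_r}$ ($\epsilon_j=\pm1$) by $\frac{\partial w}{\partial x_i}=\sum_{j=1}^{r}\epsilon_j\,\delta_{\mu_j,i}\,x_{\mu_1}^{\epsilon_1}\cdots x_{\mu_{j-1}}^{\epsilon_{j-1}}x_{\mu_j}^{\frac12(\epsilon_j-1)}$. Let $\mathfrak{a}:\mathbf{Z}[F_n]\to\mathbf{Z}[H]$ be the ring homomorphism induced by abelianization. The Magnus representation is $r_M:\mathrm{IA}_n\to\mathrm{GL}(n,\mathbf{Z}[H])$, $\sigma\mapsto\left(\mathfrak{a}\left(\frac{\partial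 (x_i^{\sigma})}{\partial x_j}\right)\right)_{i,j}$, which is a group homomorphism on $\mathrm{IA}_n$; $\mathcal{K}_n$ denotes its kernel. *)

(* Defs.v *)
From HB Require Import structures.
From mathcomp Require Import all_boot all_algebra.
From mathcomp Require Import finmap.
From mathcomp.multinomials Require Import monalg.
From mathcomp Require Import boolp classical_sets.

Set Implicit Arguments.
Unset Strict Implicit.
Unset Printing Implicit Defensive.

Import GRing.Theory.

Notation gmorphism := UMagmaMorphism.type.

Section Subgroups.
Local Open Scope classical_set_scope.
Local Open Scope group_scope.
Variable G : groupType.

Definition is_subgroup (A : set G) : Prop :=
  [/\ A 1, forall x y, A x -> A y -> A (x * y) & forall x, A x -> A x^-1].

Definition gen_subgroup (S : set G) : set G := smallest is_subgroup S.

Definition finitely_generated : Prop :=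
  exists s : seq G, gen_subgroup [set` s] = setT.

Definition commutator_subgroup : set G := gen_subgroup [set z | exists x y, z = [~ x, y]].

Lemma gen_subgroupP S : is_subgroup (gen_subgroup S).
Proof.
split=> [A [[]]|x y Sx Sy A AS|x Sx A AS] //; case: (AS) => -[A1 AM AV] _.
  by apply: AM; [apply: Sx | apply: Sy].
by apply: AV; apply: Sx.
Qed.

Lemma sub_gen_subgroup S : S `<=` gen_subgroup S.
Proof. exact: sub_gen_smallest. Qed.

Lemma gen_subgroup_min S A : is_subgroup A -> S `<=` A -> gen_subgroup S `<=` A.
Proof. by move=> sA SA; apply: smallest_sub. Qed.

Lemma commutator_subgroupJ x y : commutator_subgroup x -> commutator_subgroup (x ^ y).
Proof.
have sD := gen_subgroupP [set z | exists x y, z = [~ x, y]].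
have [_ DM _] := sD; move=> Dx.
rewrite -(mulVKg x (x ^ y)); apply: (DM) => //.
by apply: sub_gen_subgroup; exists x, y; rewrite commgEl.
Qed.

End Subgroups.

Section Abelianization.
Local Open Scope quotient_scope.
Local Open Scope group_scope.
Variable G : groupType.

(* Congruence modulo [G, G], the quotient by which is the abelianization. *)
Definition ab_rel (x y : G) : bool := `[< commutator_subgroup (x * y^-1) >].

Let dS := gen_subgroupP [set z : G | exists x y, z = [~ x, y]].

Fact ab_rel_refl : reflexive ab_rel.
Proof. by move=> x; apply/asboolP; rewrite mulgV; case: dS. Qed.

Fact ab_rel_sym : symmetric ab_rel.
Proof.
have s x y : ab_rel x y -> ab_rel y x.
  by move=> /asboolP Dxy; apply/asboolP; rewrite -invgF; case: dS => _ _; apply.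
by move=> x y; apply/idP/idP; apply: s.
Qed.

Fact ab_rel_trans : transitive ab_rel.
Proof.
move=> y x z /asboolP Dxy /asboolP Dyz; apply/asboolP.
by case: dS => _ DM _; have := DM _ _ Dxy Dyz; rewrite mulgA mulgVK.
Qed.

Canonical ab_equiv := EquivRel ab_rel ab_rel_refl ab_rel_sym ab_rel_trans.

Definition abelianization := {eq_quot ab_equiv}.
HB.instance Definition _ := Choice.on abelianization.
HB.instance Definition _ := EqQuotient.on abelianization.

Definition to_ab (x : G) : abelianization := \pi x.

Lemma to_abP x y : to_ab x = to_ab y <-> commutator_subgroup (x * y^-1).
Proof.
split=> [/eqP|D]; first by rewrite /to_ab eqmodE => /asboolP.
by apply/eqP; rewrite /to_ab eqmodE; apply/asboolP.
Qed.

Lemma to_ab_surj (u : abelianization) : to_ab (repr u) = u.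
Proof. exact: reprK. Qed.

Definition ab_one : abelianization := to_ab 1.
Definition ab_mul (u v : abelianization) := to_ab (repr u * repr v).
Definition ab_inv (u : abelianization) := to_ab (repr u)^-1.

Lemma to_ab_mul x y : ab_mul (to_ab x) (to_ab y) = to_ab (x * y).
Proof.
have [_ DM _] := dS; rewrite /ab_mul; apply/to_abP.
have /to_abP Dx := to_ab_surj (to_ab x); have /to_abP Dy := to_ab_surj (to_ab y).
move: (repr (to_ab x)) (repr (to_ab y)) Dx Dy => x' y' Dx Dy.
have -> : x' * y' * (x * y)^-1 = (y' * y^-1) ^ x'^-1 * (x' * x^-1).
  by rewrite conjgE invgK invgM !mulgA mulgVK.
by apply: DM => //; apply: commutator_subgroupJ.
Qed.

Lemma to_ab_inv x : ab_inv (to_ab x) = to_ab x^-1.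
Proof.
have [_ _ DV] := dS; rewrite /ab_inv; apply/to_abP; rewrite invgK.
have /to_abP /DV := to_ab_surj (to_ab x); move: (repr (to_ab x)) => y.
by rewrite invgF => /(@commutator_subgroupJ _ _ y); rewrite conjgE mulgVK.
Qed.

Fact ab_mulA : associative ab_mul.
Proof.
move=> u v w; rewrite -(to_ab_surj u) -(to_ab_surj v) -(to_ab_surj w).
by rewrite !to_ab_mul mulgA.
Qed.
Fact ab_mul1 : left_id ab_one ab_mul.
Proof. by move=> u; rewrite -(to_ab_surj u) to_ab_mul mul1g. Qed.
Fact ab_1mul : right_id ab_one ab_mul.
Proof. by move=> u; rewrite -(to_ab_surj u) to_ab_mul mulg1. Qed.
Fact ab_mulV : left_inverse ab_one ab_inv ab_mul.
Proof. by move=> u; rewrite -(to_ab_surj u) to_ab_inv to_ab_mul mulVg. Qed.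
Fact ab_Vmul : right_inverse ab_one ab_inv ab_mul.
Proof. by move=> u; rewrite -(to_ab_surj u) to_ab_inv to_ab_mul mulgV. Qed.

HB.instance Definition _ :=
  isGroup.Build abelianization ab_mulA ab_mul1 ab_1mul ab_mulV ab_Vmul.

Fact to_ab_monoid_morphism : monoid.monoid_morphism to_ab.
Proof. by split=> // x y; rewrite -to_ab_mul. Qed.
HB.instance Definition _ :=
  isUMagmaMorphism.Build G abelianization to_ab to_ab_monoid_morphism.

End Abelianization.

Section Kernel.
Local Open Scope group_scope.
Variables (G H : groupType) (f : gmorphism G H).

Definition kernel_pred : pred G := fun x => f x == 1.
Definition kernel := {x : G | kernel_pred x}.

Fact kernel_closed : group_closed kernel_pred.
Proof.
split=> [|x y]; rewrite !unfold_in ?gmulf1 // => /eqP fx /eqP fy.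
by rewrite gmulfF fx fy divg1.
Qed.
HB.instance Definition _ := SubChoice.copy kernel {x : G | kernel_pred x}.
HB.instance Definition _ := SubChoice_isSubGroup.Build G kernel_pred kernel kernel_closed.

End Kernel.

Section Automorphisms.
Local Open Scope group_scope.
Variable G : groupType.

Definition aut_pred : pred (G -> G) :=
  fun f => `[< bijective f /\ {morph f : x y / x * y} >].

Definition Aut := {f : G -> G | aut_pred f}.
HB.instance Definition _ := SubChoice.copy Aut {f : G -> G | aut_pred f}.

Definition aut_fun (s : Aut) : G -> G := val s.
Coercion aut_fun : Aut >-> Funclass.

Lemma aut_bij (s : Aut) : bijective s.
Proof. by have /asboolP[] := valP s. Qed.

Lemma autM (s : Aut) : {morph s : x y / x * y}.
Proof. by have /asboolP[] := valP s. Qed.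

Lemma aut_ext (s t : Aut) : s =1 t -> s = t.
Proof. by move=> st; apply/val_inj/funext. Qed.

Fact aut_one_subproof : aut_pred id.
Proof. by apply/asboolP; split=> //; exists id. Qed.
Definition aut_one : Aut := exist _ id aut_one_subproof.

Fact aut_mul_subproof (s t : Aut) : aut_pred (t \o s).
Proof.
apply/asboolP; split=> [|x y /=]; last by rewrite !autM.
exact: bij_comp (aut_bij t) (aut_bij s).
Qed.
(* Automorphisms act from the right: [s * t] is [s] followed by [t]. *)
Definition aut_mul (s t : Aut) : Aut := exist _ (t \o s) (aut_mul_subproof s t).

Fact aut_inv_subproof (s : Aut) : {t : Aut | cancel s t & cancel t s}.
Proof.
have /cid[g [sK gK]] : exists g, cancel s g /\ cancel g s.
  by case: (aut_bij s) => g sK gK; exists g.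
have gP : aut_pred g.
  apply/asboolP; split=> [|x y]; first by exists s.
  by apply: (can_inj sK); rewrite autM !gK.
by exists (exist _ g gP).
Qed.
Definition aut_inv (s : Aut) : Aut := s2val (aut_inv_subproof s).

Fact aut_mulA : associative aut_mul.
Proof. by move=> s t u; apply: aut_ext. Qed.
Fact aut_mul1 : left_id aut_one aut_mul.
Proof. by move=> s; apply: aut_ext. Qed.
Fact aut_1mul : right_id aut_one aut_mul.
Proof. by move=> s; apply: aut_ext. Qed.
Fact aut_mulV : left_inverse aut_one aut_inv aut_mul.
Proof.
by move=> s; apply: aut_ext => x; apply: (s2valP' (aut_inv_subproof s)).
Qed.
Fact aut_Vmul : right_inverse aut_one aut_inv aut_mul.
Proof.
by move=> s; apply: aut_ext => x; apply: (s2valP (aut_inv_subproof s)).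
Qed.

HB.instance Definition _ :=
  isGroup.Build Aut aut_mulA aut_mul1 aut_1mul aut_mulV aut_Vmul.

HB.instance Definition _ (s : Aut) := monoid.isMultiplicative.Build G G s (autM s).
Fact aut1 (s : Aut) : s 1 = 1.
Proof. by apply: (mulgI (s 1)); rewrite -autM !mulg1. Qed.
HB.instance Definition _ (s : Aut) :=
  Multiplicative_isUMagmaMorphism.Build G G s (aut1 s).

Lemma aut_mulE (s t : Aut) x : aut_fun (s * t) x = t (s x).
Proof. by []. Qed.

End Automorphisms.

Section AutAb.
Local Open Scope group_scope.
Variable G : groupType.

Definition ab_map (s : Aut G) (u : abelianization G) : abelianization G :=
  to_ab (s (repr u)).

Lemma commutator_subgroup_aut (s : Aut G) x :
  commutator_subgroup x -> commutator_subgroup (s x).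
Proof.
have [D1 DM DV] := gen_subgroupP [set z : G | exists x y, z = [~ x, y]].
apply: (@gen_subgroup_min _ _ [set x | commutator_subgroup (s x)]).
  split=> /= [|y z|y]; rewrite ?gmulf1 ?gmulfM ?gmulfV //; [exact: DM|exact: DV].
move=> _ /= [y [z ->]]; apply: sub_gen_subgroup; exists (s y), (s z).
by rewrite gmulfR.
Qed.

Lemma ab_mapE (s : Aut G) x : ab_map s (to_ab x) = to_ab (s x).
Proof.
apply/to_abP; rewrite -gmulfF; apply: commutator_subgroup_aut.
by apply/to_abP; rewrite to_ab_surj.
Qed.

Fact aut_ab_subproof (s : Aut G) : aut_pred (ab_map s).
Proof.
apply/asboolP; split.
  exists (ab_map s^-1) => u; rewrite -(to_ab_surj u) !ab_mapE; congr to_ab.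
    by have /(congr1 (fun t : Aut G => t (repr u))) := mulgV s.
  by have /(congr1 (fun t : Aut G => t (repr u))) := mulVg s.
move=> u v; rewrite -(to_ab_surj u) -(to_ab_surj v) -gmulfM !ab_mapE.
by rewrite !gmulfM.
Qed.
Definition aut_ab (s : Aut G) : Aut (abelianization G) :=
  exist _ (ab_map s) (aut_ab_subproof s).

Lemma aut_abE (s : Aut G) x : aut_ab s (to_ab x) = to_ab (s x).
Proof. exact: ab_mapE. Qed.

Fact aut_ab_monoid_morphism : monoid.monoid_morphism aut_ab.
Proof.
split=> [|s t]; apply: aut_ext => u; rewrite -(to_ab_surj u) aut_abE //.
by rewrite !aut_mulE !aut_abE.
Qed.
HB.instance Definition _ :=
  isUMagmaMorphism.Build (Aut G) (Aut (abelianization G)) aut_ab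
    aut_ab_monoid_morphism.

End AutAb.

Section GeneralLinearGroup.
Local Open Scope ring_scope.
Variables (n : nat) (R : nzRingType).

Definition GL_pred : pred 'M[R]_n :=
  fun A => `[< exists B, A *m B = 1%:M /\ B *m A = 1%:M >].
(* [R] need not be commutative, so the library's [unitmx] is not available. *)
Definition general_linear := {A : 'M[R]_n | GL_pred A}.
HB.instance Definition _ :=
  SubChoice.copy general_linear {A : 'M[R]_n | GL_pred A}.

Fact gl_one_subproof : GL_pred 1%:M.
Proof. by apply/asboolP; exists 1%:M; rewrite mulmx1. Qed.
Definition gl_one : general_linear := exist _ 1%:M gl_one_subproof.

Fact gl_mul_subproof (A B : general_linear) : GL_pred (val A *m val B).
Proof.
have /asboolP[A' [AA' A'A]] := valP A; have /asboolP[B' [BB' B'B]] := valP B.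
apply/asboolP; exists (B' *m A'); split.
  by rewrite mulmxA -(mulmxA (val A)) BB' mulmx1.
by rewrite mulmxA -(mulmxA B') A'A mulmx1.
Qed.
Definition gl_mul (A B : general_linear) : general_linear :=
  exist _ (val A *m val B) (gl_mul_subproof A B).

Fact gl_inv_subproof (A : general_linear) :
  {B : general_linear | val A *m val B = 1%:M & val B *m val A = 1%:M}.
Proof.
have /asboolP/cid[B [AB BA]] := valP A.
have BP : GL_pred B by apply/asboolP; exists (val A).
by exists (exist _ B BP).
Qed.
Definition gl_inv (A : general_linear) : general_linear :=
  s2val (gl_inv_subproof A).

Fact gl_mulA : associative gl_mul.
Proof. by move=> A B C; apply/val_inj; rewrite /= mulmxA. Qed.
Fact gl_mul1 : left_id gl_one gl_mul.
Proof. by move=> A; apply/val_inj; rewrite /= mul1mx. Qed.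
Fact gl_1mul : right_id gl_one gl_mul.
Proof. by move=> A; apply/val_inj; rewrite /= mulmx1. Qed.
Fact gl_mulV : left_inverse gl_one gl_inv gl_mul.
Proof. by move=> A; apply/val_inj; apply: (s2valP' (gl_inv_subproof A)). Qed.
Fact gl_Vmul : right_inverse gl_one gl_inv gl_mul.
Proof. by move=> A; apply/val_inj; apply: (s2valP (gl_inv_subproof A)). Qed.

HB.instance Definition _ :=
  isGroup.Build general_linear gl_mulA gl_mul1 gl_1mul gl_mulV gl_Vmul.

End GeneralLinearGroup.

Section FreeGroup.
Local Open Scope group_scope.
Variable n : nat.

(* The letter [(i, false)] stands for x_i and [(i, true)] for x_i^-1. *)
Definition letter := ('I_n * bool)%type.
Definition letter_inv (a : letter) : letter := (a.1, ~~ a.2).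

Definition reduced (w : seq letter) : bool :=
  sorted (fun a b => b != letter_inv a) w.

Definition free_group := {w : seq letter | reduced w}.
HB.instance Definition _ :=
  SubChoice.copy free_group {w : seq letter | reduced w}.

(* Left multiplication of a reduced word by one letter. *)
Definition push (a : letter) (w : seq letter) : seq letter :=
  if w is b :: w' then if b == letter_inv a then w' else a :: w else [:: a].

Definition reduce (w : seq letter) : seq letter := foldr push [::] w.

Lemma letter_invK : involutive letter_inv.
Proof. by case=> i b; rewrite /letter_inv /= negbK. Qed.

Lemma push_reduced a w : reduced w -> reduced (push a w).
Proof.
case: w => [|b w] //= bw; case: eqP => [_|/eqP ba /=]; last by rewrite ba.
exact: path_sorted bw.
Qed.

Lemma foldr_push_reduced w v : reduced v -> reduced (foldr push v w).
Proof. by move=> rv; elim: w => //= a w; apply: push_reduced. Qed.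

Lemma reduce_reduced w : reduced (reduce w).
Proof. exact: foldr_push_reduced. Qed.

Lemma push_cons a w : reduced (a :: w) -> push a w = a :: w.
Proof. by case: w => [|b w] //= /andP[/negbTE ->]. Qed.

Lemma reduce_id w : reduced w -> reduce w = w.
Proof.
elim: w => [|a w IHw] //= raw; rewrite IHw; first exact: push_cons.
exact: path_sorted raw.
Qed.

Lemma pushK a w : reduced w -> push (letter_inv a) (push a w) = w.
Proof.
case: w => [|b w] rw /=; first by rewrite letter_invK eqxx.
have [ba|_] := eqVneq b (letter_inv a); last by rewrite /= letter_invK eqxx.
by rewrite -ba push_cons.
Qed.

Lemma foldr_push_push a u v : reduced v ->
  foldr push v (push a u) = push a (foldr push v u).
Proof.
move=> rv; case: u => [|b u] //=; case: eqP => [->|] //.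
have := pushK (letter_inv a) (foldr_push_reduced u rv).
by rewrite letter_invK => ->.
Qed.

Lemma foldr_push_reduce u v : reduced v ->
  foldr push v (reduce u) = foldr push v u.
Proof.
by move=> rv; elim: u => [|a u IHu] //=; rewrite foldr_push_push // IHu.
Qed.

Definition word_inv (w : seq letter) := rev (map letter_inv w).

Lemma word_inv_reduced w : reduced w -> reduced (word_inv w).
Proof.
rewrite /reduced /word_inv rev_sorted sorted_map; apply: sub_sorted => a b /=.
by apply: contra => /eqP ->; rewrite letter_invK.
Qed.

Definition fg_one : free_group := exist _ [::] isT.
Definition fg_mul (u v : free_group) : free_group :=
  exist _ (reduce (val u ++ val v)) (reduce_reduced _).
Definition fg_inv (u : free_group) : free_group :=
  exist _ (word_inv (val u)) (word_inv_reduced (valP u)).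

Lemma fg_mulE u v : val (fg_mul u v) = foldr push (val v) (val u).
Proof.
by rewrite /= /reduce foldr_cat -/(reduce (val v)) reduce_id //; apply: valP.
Qed.

Fact fg_mulA : associative fg_mul.
Proof.
move=> u v w; apply/val_inj; rewrite fg_mulE fg_mulE [RHS]fg_mulE /=.
by rewrite foldr_push_reduce ?foldr_cat //; apply: (valP w).
Qed.
Fact fg_mul1 : left_id fg_one fg_mul.
Proof. by move=> u; apply/val_inj; rewrite fg_mulE. Qed.
Fact fg_1mul : right_id fg_one fg_mul.
Proof. by move=> u; apply/val_inj; rewrite fg_mulE; exact: reduce_id (valP u). Qed.
Fact fg_mulV : left_inverse fg_one fg_inv fg_mul.
Proof.
move=> u; apply/val_inj; rewrite fg_mulE /=.
case: u => w /= _; rewrite /word_inv; elim: w => //= a w IHw.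
by rewrite rev_cons foldr_rcons /= letter_invK eqxx.
Qed.
Fact fg_Vmul : right_inverse fg_one fg_inv fg_mul.
Proof.
move=> u; have {1}-> : u = fg_inv (fg_inv u); last exact: fg_mulV.
apply/val_inj; rewrite /= /word_inv map_rev revK -map_comp.
by rewrite map_id_in // => a _; apply: letter_invK.
Qed.

HB.instance Definition _ :=
  isGroup.Build free_group fg_mulA fg_mul1 fg_1mul fg_mulV fg_Vmul.

Definition gen (i : 'I_n) : free_group := exist _ [:: (i, false)] isT.

Definition letter_val (a : letter) : free_group :=
  if a.2 then (gen a.1)^-1 else gen a.1.

Definition word_val (w : seq letter) : free_group :=
  \prod_(a <- w) letter_val a.

Lemma letter_valE a : val (letter_val a) = [:: a].
Proof. by case: a => i []. Qed.

Lemma word_valE w : val (word_val w) = reduce w.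
Proof.
rewrite /word_val; elim: w => [|a w IHw]; first by rewrite big_nil.
by rewrite big_cons fg_mulE IHw letter_valE.
Qed.

Lemma word_valK (w : free_group) : word_val (val w) = w.
Proof. by apply/val_inj; rewrite word_valE reduce_id // (valP w). Qed.

End FreeGroup.

Definition group_ring (G : groupType) := {malg int[G]}.
HB.instance Definition _ G := Choice.on (group_ring G).
HB.instance Definition _ G := GRing.Zmodule.on (group_ring G).

(* [of_group] and [lin_ext] are locked because comparing two of their instances
   by conversion would unfold finitely supported functions. *)
HB.lock Definition of_group (G : groupType) (g : G) : group_ring G :=
  (<< g >>)%R.

(* The additive extension to Z[G] of a function defined on G. *)
HB.lock Definition lin_ext (G : groupType) (V : zmodType) (f : G -> V)
    (a : group_ring G) : V :=
  (\sum_(g <- msupp a) f g *~ a@_g)%R.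

Section GroupRing.
Local Open Scope ring_scope.
Variable G : groupType.
Local Notation ZG := (group_ring G).

Lemma lin_extw (V : zmodType) (f : G -> V) (a : ZG) (D : {fset G}) :
  (msupp a `<=` D)%fset -> lin_ext f a = \sum_(g <- D) f g *~ a@_g.
Proof.
rewrite lin_ext.unlock => aD; apply: big_fset_incl => // g _ /mcoeff_outdom ->.
by rewrite mulr0z.
Qed.

Fact lin_ext_additive (V : zmodType) (f : G -> V) :
  {morph lin_ext f : a b / a - b}.
Proof.
move=> a b; pose D := (msupp a `|` msupp b)%fset.
rewrite (@lin_extw _ f a D) ?fsubsetUl // (@lin_extw _ f b D) ?fsubsetUr //.
rewrite (@lin_extw _ f _ D); last exact: msuppB_le.
rewrite -sumrB; apply: eq_bigr => g _; rewrite -mulrzBr; congr (_ *~ _).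
exact: (mcoeffB g a b).
Qed.
HB.instance Definition _ (V : zmodType) (f : G -> V) :=
  GRing.isZmodMorphism.Build ZG V (lin_ext f) (lin_ext_additive f).

Lemma lin_extE (V : zmodType) (f : G -> V) g : lin_ext f (of_group g) = f g.
Proof.
rewrite of_group.unlock (lin_extw f (D := [fset g]%fset)) ?msuppU_le //.
by rewrite big_seq_fset1 mcoeffUU.
Qed.

Lemma of_groupZ c (g : G) : << c *g g >> = of_group g *~ c :> ZG.
Proof.
by rewrite of_group.unlock -{1}(intz c); apply: (raddfMz (@mkmalgU G int g)).
Qed.

Lemma group_ring_ind (P : ZG -> Prop) :
  (forall a b, P a -> P b -> P (a - b)) -> P 0 -> (forall g, P (of_group g)) ->
  forall a, P a.
Proof.
move=> PB P0 Pg a; rewrite (monalgE a : a = _ :> ZG).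
have PN b : P b -> P (- b) by move=> Pb; rewrite -[- b]add0r; apply: PB.
have PD b c : P b -> P c -> P (b + c).
  by move=> Pb Pc; rewrite -[c]opprK; apply: PB => //; apply: PN.
have PM b m : P b -> P (b *+ m).
  by move=> Pb; elim: m => [|m IHm] //; rewrite mulrS; apply: PD.
apply: big_ind => // g _; rewrite of_groupZ; case: (mcoeff g a) => m.
  by rewrite -pmulrn; apply: PM.
by rewrite NegzE mulrNz -pmulrn; apply/PN/PM.
Qed.

Definition gr_one : ZG := of_group 1%g.
Definition gr_mul (a b : ZG) : ZG :=
  lin_ext (fun g => lin_ext (fun h => of_group (g * h)%g) b) a.

Lemma gr_mulBl a b c : gr_mul (a - b) c = gr_mul a c - gr_mul b c.
Proof. exact: raddfB. Qed.

Lemma gr_mulBr a b c : gr_mul a (b - c) = gr_mul a b - gr_mul a c.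
Proof.
rewrite /gr_mul !(@lin_extw _ _ a (msupp a)) ?fsubset_refl // -sumrB.
apply: eq_bigr => g _.
by rewrite -mulrzBl raddfB.
Qed.

Lemma gr_mul0l a : gr_mul 0 a = 0. Proof. exact: raddf0. Qed.
Lemma gr_mul0r a : gr_mul a 0 = 0.
Proof. by rewrite -[0 in LHS](subrr 0) gr_mulBr subrr. Qed.

Lemma gr_mulDl : left_distributive gr_mul +%R.
Proof. by move=> a b c; apply: raddfD. Qed.

Lemma gr_mulDr : right_distributive gr_mul +%R.
Proof.
by move=> a b c; rewrite -{1}(opprK c) gr_mulBr -[- c]add0r gr_mulBr gr_mul0r
  add0r opprK.
Qed.

Lemma gr_mulUU g h : gr_mul (of_group g) (of_group h) = of_group (g * h)%g.
Proof. by rewrite /gr_mul !lin_extE. Qed.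

Lemma gr_mulA : associative gr_mul.
Proof.
move=> a b c; elim/group_ring_ind: a => [a a' Pa Pa'||x].
- by rewrite !gr_mulBl Pa Pa'.
- by rewrite !gr_mul0l.
elim/group_ring_ind: b => [b b' Pb Pb'||y].
- by rewrite gr_mulBl !gr_mulBr gr_mulBl Pb Pb'.
- by rewrite gr_mul0l !gr_mul0r gr_mul0l.
elim/group_ring_ind: c => [c c' Pc Pc'||z].
- by rewrite !gr_mulBr Pc Pc'.
- by rewrite !gr_mul0r.
by rewrite !gr_mulUU mulgA.
Qed.

Lemma gr_mul1 : left_id gr_one gr_mul.
Proof.
elim/group_ring_ind=> [a b Pa Pb||x]; first by rewrite gr_mulBr Pa Pb.
  by rewrite gr_mul0r.
by rewrite gr_mulUU mul1g.
Qed.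

Lemma gr_1mul : right_id gr_one gr_mul.
Proof.
elim/group_ring_ind=> [a b Pa Pb||x]; first by rewrite gr_mulBl Pa Pb.
  by rewrite gr_mul0l.
by rewrite gr_mulUU mulg1.
Qed.

Lemma gr_one_neq0 : gr_one != 0.
Proof. by rewrite /gr_one of_group.unlock monalgU_eq0. Qed.

HB.instance Definition _ := GRing.Zmodule_isNzRing.Build (group_ring G)
  gr_mulA gr_mul1 gr_1mul gr_mulDl gr_mulDr gr_one_neq0.

Lemma of_groupM g h : of_group (g * h)%g = of_group g * of_group h.
Proof. by rewrite -gr_mulUU. Qed.

Lemma of_group1 : of_group 1%g = 1.
Proof. by []. Qed.

End GroupRing.

Section GroupRingMap.
Local Open Scope ring_scope.
Variables (G H : groupType) (f : gmorphism G H).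

Definition group_ring_map : group_ring G -> group_ring H :=
  lin_ext (fun g => of_group (f g)).

HB.instance Definition _ := GRing.Additive.on group_ring_map.

Lemma group_ring_mapE g : group_ring_map (of_group g) = of_group (f g).
Proof. exact: lin_extE. Qed.

Fact group_ring_map_monoid_morphism : GRing.monoid_morphism group_ring_map.
Proof.
split=> [|a b]; first by rewrite -of_group1 group_ring_mapE gmulf1.
have mB : {morph group_ring_map : a b / a - b} := raddfB _.
have m0 : group_ring_map 0 = 0 := raddf0 _.
elim/group_ring_ind: a => [a a' Pa Pa'||x].
- by rewrite mulrBl !mB Pa Pa' mulrBl.
- by rewrite mul0r m0 mul0r.
elim/group_ring_ind: b => [b b' Pb Pb'||y].
- by rewrite mulrBr !mB Pb Pb' mulrBr.
- by rewrite mulr0 m0 mulr0.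
by rewrite -of_groupM !group_ring_mapE gmulfM of_groupM.
Qed.
HB.instance Definition _ :=
  GRing.isMonoidMorphism.Build (group_ring G) (group_ring H) group_ring_map
    group_ring_map_monoid_morphism.

End GroupRingMap.

Section FoxCalculus.
Local Open Scope ring_scope.
Variable n : nat.
Local Notation F := (free_group n).
Local Notation ZF := (group_ring F).

(* The contribution to the derivative of a letter [a] preceded by a word of value
   [u]: the exponent of [a.1] in the last factor is (eps - 1) / 2, where
   eps = (-1) ^+ a.2 is the exponent carried by [a]. *)
Definition fox_letter (i : 'I_n) (a : letter n) (u : F) : ZF :=
  of_group (u * if a.2 then (gen a.1)^-1 else 1)%g *~
    ((-1) ^+ a.2 * (a.1 == i)%:R).

Definition fox_word (i : 'I_n) (w : seq (letter n)) : ZF :=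
  \sum_(k < size w)
    fox_letter i (tnth (in_tuple w) k) (word_val (take k w)).

Definition fox (i : 'I_n) : ZF -> ZF := lin_ext (fun w : F => fox_word i (val w)).
HB.instance Definition _ i := GRing.Additive.on (fox i).

Lemma fox_letterM i a u v :
  fox_letter i a (u * v)%g = of_group u * fox_letter i a v.
Proof.
by rewrite /fox_letter -!mulgA of_groupM mulrzAr.
Qed.

Lemma fox_word0 i : fox_word i [::] = 0.
Proof. exact: big_ord0. Qed.

Lemma fox_word_cons i a w :
  fox_word i (a :: w) =
    fox_letter i a 1%g + of_group (letter_val a) * fox_word i w.
Proof.
rewrite /fox_word big_ord_recl /= /word_val big_nil; congr (_ + _).
rewrite mulr_sumr; apply: eq_bigr => k _; rewrite -fox_letterM.
by rewrite !(tnth_nth a) /= big_cons.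
Qed.

Lemma fox_letterV i a :
  fox_letter i a 1%g +
    of_group (letter_val a) * fox_letter i (letter_inv a) 1%g = 0.
Proof.
case: a => j b; rewrite -fox_letterM mulg1 /fox_letter /letter_val /=.
case: b => /=; rewrite mul1g ?mulg1 ?mulgV -mulrzDr.
  by rewrite -mulrDl addrC subrr mul0r mulr0z.
by rewrite -mulrDl subrr mul0r mulr0z.
Qed.

Lemma fox_word_push i a w :
  fox_word i (push a w) =
    fox_letter i a 1%g + of_group (letter_val a) * fox_word i w.
Proof.
case: w => [|b w] /=; first by rewrite fox_word_cons.
case: eqP => [->|_]; last by rewrite fox_word_cons.
rewrite fox_word_cons mulrDr addrA fox_letterV add0r mulrA -of_groupM.
suff -> : (letter_val a * letter_val (letter_inv a) = 1)%g by rewrite of_group1 mul1r.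
by case: a => j []; rewrite /letter_val /= ?mulVg ?mulgV.
Qed.

Lemma fox_word_foldr_push i v w :
  fox_word i (foldr (@push n) v w) =
    fox_word i w + of_group (word_val w) * fox_word i v.
Proof.
elim: w => [|a w IHw]; first by rewrite /word_val big_nil fox_word0 add0r of_group1 mul1r.
rewrite [foldr _ _ _]/= fox_word_push IHw fox_word_cons.
by rewrite {2}/word_val big_cons of_groupM mulrDr mulrA addrA.
Qed.

Lemma foxE i (w : F) : fox i (of_group w) = fox_word i (val w).
Proof. exact: lin_extE. Qed.

Lemma foxM i (u v : F) :
  fox i (of_group (u * v)%g) =
    fox i (of_group u) + of_group u * fox i (of_group v).
Proof.
have E : val (u * v)%g = foldr (@push n) (val v) (val u) := fg_mulE u v.
by rewrite foxE E fox_word_foldr_push -!foxE word_valK.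
Qed.

Lemma fox_gen i j : fox i (of_group (gen j)) = (j == i)%:R.
Proof.
rewrite foxE fox_word_cons fox_word0 mulr0 addr0 /fox_letter /=.
by rewrite !mulg1 expr0 mul1r natz -pmulrn.
Qed.

(* Two crossed homomorphisms that agree on the basis are equal. *)
Lemma crossed_eq (R : nzRingType) (phi d1 d2 : F -> R) :
  phi 1%g = 1 ->
  (forall u v, d1 (u * v)%g = d1 u + phi u * d1 v) ->
  (forall u v, d2 (u * v)%g = d2 u + phi u * d2 v) ->
  (forall i, d1 (gen i) = d2 (gen i)) -> d1 =1 d2.
Proof.
move=> phi1 d1M d2M d12.
have z d : (forall u v, d (u * v)%g = d u + phi u * d v) -> d 1%g = 0.
  move=> dM; have := dM 1%g 1%g; rewrite mulg1 phi1 mul1r => /eqP.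
  by rewrite -subr_eq subrr => /eqP.
have V d u : (forall u v, d (u * v)%g = d u + phi u * d v) ->
    d (u^-1)%g = - (phi (u^-1)%g * d u).
  by move=> dM; apply/eqP; rewrite -addr_eq0 -dM mulVg z.
move=> u; rewrite -(word_valK u) /word_val.
elim: (val u) => [|[j b] w IHw]; first by rewrite big_nil !z.
rewrite big_cons d1M d2M IHw; congr (_ + _).
by case: b; rewrite /letter_val /= ?(V d1) ?(V d2) ?d12.
Qed.

End FoxCalculus.

Section Magnus.
Local Open Scope ring_scope.
Variable n : nat.
Local Notation F := (free_group n).
Local Notation H := (abelianization F).

Definition IA := kernel (@aut_ab F).
HB.instance Definition _ := monoid.Group.on IA.

Definition ab_ring : group_ring F -> group_ring H := group_ring_map (@to_ab F).
HB.instance Definition _ := GRing.RMorphism.on ab_ring.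

Definition magnus_mx (s : Aut F) : 'M[group_ring H]_n :=
  \matrix_(i, j) ab_ring (fox j (of_group (s (gen i)))).

Lemma IA_to_ab (s : IA) x : to_ab (aut_fun (val s) x) = to_ab x.
Proof. by rewrite -aut_abE (eqP (valP s)). Qed.

(* The chain rule, after abelianization of the coefficients. *)
Lemma magnus_chain (s : IA) j (u : F) :
  ab_ring (fox j (of_group (aut_fun (val s) u))) =
  \sum_k ab_ring (fox k (of_group u)) * magnus_mx (val s) k j.
Proof.
pose phi (v : F) := ab_ring (of_group v).
pose d1 u := ab_ring (fox j (of_group (aut_fun (val s) u))).
pose d2 u := \sum_k ab_ring (fox k (of_group u)) * magnus_mx (val s) k j.
have aD : {morph ab_ring : a b / a + b} := rmorphD _.
have aM : {morph ab_ring : a b / a * b} := rmorphM _.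
have a1 : ab_ring 1 = 1 := rmorph1 _.
have a0 : ab_ring 0 = 0 := rmorph0 _.
apply: (@crossed_eq _ _ phi d1 d2) u => [|u v|u v|i].
- by rewrite /phi of_group1 a1.
- rewrite /d1 (autM (val s)) foxM aD aM; congr (_ + _ * _).
  rewrite /phi /ab_ring !group_ring_mapE; congr of_group; exact: IA_to_ab.
- rewrite /d2 mulr_sumr -big_split; apply: eq_bigr => k _ /=.
  by rewrite foxM aD aM mulrDl mulrA.
rewrite /d2 (bigD1 i) //= fox_gen eqxx a1 mul1r big1 ?addr0 => [|k ki].
  by rewrite mxE.
by rewrite fox_gen eq_sym (negbTE ki) a0 mul0r.
Qed.

Lemma magnus_mxM (s t : IA) :
  magnus_mx (val (s * t)%g) = magnus_mx (val s) *m magnus_mx (val t).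
Proof.
apply/matrixP => i j; rewrite !mxE /= aut_mulE magnus_chain.
by apply: eq_bigr => k _; rewrite !mxE.
Qed.

Lemma magnus_mx1 : magnus_mx (val (1%g : IA)) = 1%:M.
Proof.
by apply/matrixP => i j; rewrite !mxE fox_gen rmorph_nat.
Qed.

Fact magnus_subproof (s : IA) : GL_pred (magnus_mx (val s)).
Proof.
apply/asboolP; exists (magnus_mx (val (s^-1)%g)).
by rewrite -!magnus_mxM mulgV mulVg magnus_mx1.
Qed.

Definition magnus (s : IA) : general_linear n (group_ring H) :=
  exist _ (magnus_mx (val s)) (magnus_subproof s).

Fact magnus_monoid_morphism : monoid.monoid_morphism magnus.
Proof.
by split=> [|s t]; apply/val_inj; [exact: magnus_mx1 | exact: magnus_mxM].
Qed.
HB.instance Definition _ :=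
  isUMagmaMorphism.Build IA (general_linear n (group_ring H)) magnus
    magnus_monoid_morphism.

Definition magnus_kernel := kernel magnus.
HB.instance Definition _ := monoid.Group.on magnus_kernel.

End Magnus.

(* Main.v *)
Require Import Defs.
From mathcomp Require Import all_boot.
From HB Require Import structures.
From mathcomp Require Import all_order all_algebra.
From mathcomp Require Import boolp classical_sets.
From mathcomp Require Import ring lra zify.

Set Implicit Arguments.
Unset Strict Implicit.
Unset Printing Implicit Defensive.

Import Order.TTheory GRing.Theory Num.Theory.

(** Let F be the free group and K the kernel of the Magnus representation. If
    the abelianization of K were finitely generated, then every additive map
    from K to the rationals would have values with a common denominator
    ([fg_abelianization_bounded_denominators]). The proof exhibits an additive
    map K -> Q whose values have arbitrarily large denominators.

    Call delta : F -> Q a derivation for two characters chi, chi' when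
    delta (u v) = chi u * delta v + delta u * chi' v; equivalently,
    (chi, delta; 0, chi') is a triangular representation of degree 2. By the
    chain rule such a delta is determined by the abelianized Fox derivatives,
    which K fixes, so delta (u^s) = delta u for all s in K
    ([magnus_kernel_derivation]).

    Now let rho be an upper triangular representation of degree 3. Its two
    superdiagonal entries b = rho_01 and f = rho_12 are derivations, hence
    invariant under K. The corner entry q = rho_02 is not a derivation, but its
    defect b u * f v is K-invariant. Therefore, for s in K, the difference
    w |-> q (w^s) - q w is a derivation; being a derivation, it is itself
    invariant under K, which makes s |-> q (w^s) - q w additive on K for every
    fixed w ([corner_shiftM]). This is a numerical form of a Johnson
    homomorphism, attached to the lower central series of F' = [F, F].

    The map is far from zero on inner automorphisms. Conjugation by g = [u, v]
    with u, v in F' belongs to K ([inner_commg_kernel]), and there the map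
    equals q g * (rho_00 w - rho_22 w), where q g = b u * f v - b v * f u. With
    w = x_1, rho x_1 = diag(2, 1, -1), rho x_2 a unipotent Jordan block,
    u = [x_1, x_2] and v the conjugate of u by x_1 ^ k, the value is
    3 * (-1) ^ k - 3 / 2 ^ k ([corner_shift_unbounded]), whose denominator
    grows with k. *)

(** * Maps from a group to a commutative monoid *)

Section FactorThroughAbelianization.
Local Open Scope group_scope.
Variables (G : groupType) (T : Type) (idx : T) (op : Monoid.com_law idx).
Variable f : G -> T.
Hypotheses (f1 : f 1 = idx) (fM : forall x y, f (x * y) = op (f x) (f y)).

(** The values of [f] on a group commute and are invertible, so [f] is trivial on
    commutators although [T] need not be a group; additive and multiplicative
    maps to a field are both instances. *)
Lemma com_hom_commutator x : commutator_subgroup x -> f x = idx.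
Proof.
apply: (@gen_subgroup_min _ _ [set x | f x = idx]).
  split=> //= [y z fy fz|y fy]; first by rewrite fM fy fz Monoid.mul1m.
  by rewrite -f1 -(mulVg y) fM fy Monoid.mulm1.
move=> _ /= [y [z ->]].
rewrite commgEl conjgE !fM (Monoid.mulmCA op (f z^-1)) Monoid.mulmA.
by rewrite /= -!fM !mulVg mulg1.
Qed.

Lemma com_hom_to_ab x y : to_ab x = to_ab y -> f x = f y.
Proof.
move=> /to_abP /com_hom_commutator fxy.
by rewrite -(mulgVK y x) fM fxy Monoid.mul1m.
Qed.

Lemma com_hom_repr x : f (repr (to_ab x)) = f x.
Proof. by apply: com_hom_to_ab; rewrite to_ab_surj. Qed.

End FactorThroughAbelianization.

(** * Denominators of additive maps to the rationals *)

Section FiniteGeneration.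
Local Open Scope ring_scope.

Lemma common_denominator (s : seq rat) :
  exists2 d : int, 0 < d & {in s, forall x, d%:~R * x \is a Num.int}.
Proof.
elim: s => [|x s [d d_gt0 IHs]]; first by exists 1.
exists (d * denq x); first by rewrite mulr_gt0 ?denq_gt0.
move=> y; rewrite inE intrM mulrAC => /predU1P[->|/IHs dy].
  by rewrite -mulrA -numqE -intrM intr_int.
by rewrite rpredM ?intr_int.
Qed.

(** An additive map factors through the abelianization, and the classes on which
    it becomes integral after scaling by a fixed [d] form a subgroup; so it is
    enough that [d] clears the denominators on a finite generating set. *)
Lemma fg_abelianization_bounded_denominators (G : groupType) (f : G -> rat) :
  (forall x y, f (x * y)%g = f x + f y) ->
  finitely_generated (abelianization G) ->
  exists2 d : int, 0 < d & forall x, d%:~R * f x \is a Num.int.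
Proof.
move=> fM [s s_gen].
have f1 : f 1%g = 0 by apply: (addrI (f 1%g)); rewrite -fM mulg1 addr0.
have f_repr x : f (repr (to_ab x)) = f x by exact: (com_hom_repr f1 fM).
have [d d_gt0 ds] := common_denominator [seq f (repr u) | u <- s].
exists d => // x; rewrite -f_repr.
have : gen_subgroup [set` s] (to_ab x) by rewrite s_gen.
pose integral :=
  [set u : abelianization G | d%:~R * f (repr u) \is a Num.int]%classic.
apply: (@gen_subgroup_min _ _ integral) (to_ab x).
  rewrite /integral; split=> /= [|u v du dv|u du].
  - by rewrite (f_repr 1%g) f1 mulr0.
  - rewrite -(to_ab_surj u) -(to_ab_surj v) -gmulfM f_repr fM mulrDr.
    by rewrite rpredD.
  rewrite -(to_ab_surj u) -gmulfV f_repr.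
  have -> : f (repr u)^-1%g = - f (repr u).
    by apply/eqP; rewrite -addr_eq0 -fM mulVg f1.
  by rewrite mulrN rpredN.
by move=> u /= su; apply: ds; apply: map_f.
Qed.

End FiniteGeneration.

(** * Derivations are invariant under the Magnus kernel *)

Section AbelianizedFoxDerivatives.
Local Open Scope ring_scope.
Variable n : nat.
Local Notation F := (free_group n).

Lemma ab_foxM j (u v : F) : ab_ring (fox j (of_group (u * v)%g)) =
  ab_ring (fox j (of_group u))
    + of_group (to_ab u) * ab_ring (fox j (of_group v)).
Proof.
rewrite foxM (rmorphD (@ab_ring n)) (rmorphM (@ab_ring n)) /=.
by congr (_ + _ * _); apply: group_ring_mapE.
Qed.

Lemma ab_fox_gen j (i : 'I_n) :
  ab_ring (fox j (of_group (gen i))) = (i == j)%:R.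
Proof. by rewrite fox_gen; apply: rmorph_nat. Qed.

End AbelianizedFoxDerivatives.

Section Derivations.
Local Open Scope ring_scope.
Variables (n : nat) (K : fieldType).
Local Notation F := (free_group n).

Definition character (chi : F -> K) : Prop :=
  chi 1%g = 1 /\ forall u v, chi (u * v)%g = chi u * chi v.

Definition derivation (chi chi' delta : F -> K) : Prop :=
  forall u v, delta (u * v)%g = chi u * delta v + delta u * chi' v.

Lemma character_neq0 chi u : character chi -> chi u != 0.
Proof.
move=> [chi1 chiM]; apply/negP => /eqP chi0.
by have := oner_eq0 K; rewrite -chi1 -(mulgV u) chiM chi0 mul0r eqxx.
Qed.

Lemma character_to_ab chi u v :
  character chi -> to_ab u = to_ab v -> chi u = chi v.
Proof. by move=> [chi1 chiM]; apply: (com_hom_to_ab chi1 chiM). Qed.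

Definition character_ext (psi : F -> K) : group_ring (abelianization F) -> K :=
  lin_ext (fun h : abelianization F => psi (repr h)).
HB.instance Definition _ psi := GRing.Additive.on (character_ext psi).

Lemma character_ext_to_ab psi u :
  character psi -> character_ext psi (of_group (to_ab u)) = psi u.
Proof.
move=> psiP; rewrite /character_ext lin_extE.
by apply: character_to_ab => //; rewrite to_ab_surj.
Qed.

Lemma character_extM psi u a : character psi ->
  character_ext psi (of_group (to_ab u) * a) = psi u * character_ext psi a.
Proof.
move=> psiP; have [_ psiM] := psiP.
have eB : {morph character_ext psi : a b / a - b} := raddfB _.
have e0 : character_ext psi 0 = 0 := raddf0 _.
elim/group_ring_ind: a => [a b Pa Pb||h].
- by rewrite mulrBr !eB Pa Pb mulrBr.
- by rewrite mulr0 e0 mulr0.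
by rewrite -of_groupM -(to_ab_surj h) -gmulfM !character_ext_to_ab.
Qed.

(** The abelianized Fox derivatives are universal: both sides are crossed
    homomorphisms for [psi], and they agree on the basis. *)
Lemma crossed_fox_chain (psi D : F -> K) : character psi ->
    (forall u v, D (u * v)%g = D u + psi u * D v) ->
  forall u, D u =
    \sum_j character_ext psi (ab_ring (fox j (of_group u))) * D (gen j).
Proof.
move=> psiP DM; have [psi1 psiM] := psiP.
have eD : {morph character_ext psi : a b / a + b} := raddfD _.
have e0 : character_ext psi 0 = 0 := raddf0 _.
have e1 : character_ext psi 1 = 1.
  by rewrite -psi1 -(character_ext_to_ab 1%g psiP) -of_group1.
apply: (@crossed_eq _ _ psi) => // [u v|i].
  rewrite mulr_sumr -big_split; apply: eq_bigr => j _ /=.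
  by rewrite ab_foxM eD character_extM // mulrDl mulrA.
rewrite (bigD1 i) //= ab_fox_gen eqxx e1 mul1r big1 ?addr0 // => j ji.
by rewrite ab_fox_gen eq_sym (negbTE ji) e0 mul0r.
Qed.

(** The chain rule with the identity as Magnus matrix. *)
Lemma magnus_kernel_fox (s : magnus_kernel n) j u :
  ab_ring (fox j (of_group (aut_fun (val (val s)) u))) =
  ab_ring (fox j (of_group u)).
Proof.
rewrite magnus_chain.
have /eqP/(congr1 val) /= -> := valP s.
rewrite (bigD1 j) //= mxE eqxx mulr1 big1 ?addr0 // => k kj.
by rewrite mxE (negbTE kj) mulr0.
Qed.

Lemma magnus_kernel_to_ab (s : magnus_kernel n) u :
  to_ab (aut_fun (val (val s)) u) = to_ab u.
Proof. exact: IA_to_ab. Qed.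

(** Dividing [delta] by [chi'] gives a crossed homomorphism for [chi / chi'], which
    depends only on abelianized Fox derivatives; and [chi'] itself is unchanged
    because automorphisms in the kernel act trivially on the abelianization. *)
Lemma magnus_kernel_derivation (chi chi' delta : F -> K) (s : magnus_kernel n) :
  character chi -> character chi' -> derivation chi chi' delta ->
  forall u, delta (aut_fun (val (val s)) u) = delta u.
Proof.
move=> chiP chiP' deltaM u.
have c0 v : chi' v != 0 by apply: character_neq0.
have [[chi1 chiM] [chi1' chiM']] := (chiP, chiP').
pose D v := delta v / chi' v.
suff: D (aut_fun (val (val s)) u) = D u.
  rewrite /D (character_to_ab chiP' (magnus_kernel_to_ab s u)).
  by apply: divIf.
have psiP : character (fun v => chi v / chi' v).
  by split=> [|v w]; rewrite ?chi1 ?chi1' ?divr1 // chiM chiM' invfM mulrACA.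
have DM v w : D (v * w)%g = D v + chi v / chi' v * D w.
  by rewrite /D deltaM chiM'; field; rewrite !c0.
rewrite !(crossed_fox_chain psiP DM).
by apply: eq_bigr => j _; rewrite magnus_kernel_fox.
Qed.

End Derivations.

(** * Inner automorphisms in the Magnus kernel *)

Section InnerAutomorphisms.
Local Open Scope ring_scope.

Fact inner_aut_subproof (G : groupType) (g : G) : aut_pred (conjg^~ g : G -> G).
Proof.
apply/asboolP; split=> [|x y]; last exact: conjMg.
by exists (conjg^~ g^-1%g); [exact: conjgK | exact: conjgKV].
Qed.

Definition inner_aut (G : groupType) (g : G) : Aut G :=
  exist _ (conjg^~ g) (inner_aut_subproof g).

Lemma to_ab_commg (G : groupType) (u v : G) : to_ab [~ u, v]%g = 1%g.
Proof.
have -> : 1%g = to_ab 1%g :> abelianization G by [].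
by apply/to_abP; rewrite invg1 mulg1; apply: sub_gen_subgroup; exists u, v.
Qed.

Lemma to_ab_conjg (G : groupType) (u v : G) : to_ab (u ^ v)%g = to_ab u.
Proof. by rewrite -(mulVKg u (u ^ v)%g) -commgEl gmulfM /= to_ab_commg mulg1. Qed.

Variable n : nat.
Local Notation F := (free_group n).

(** On the commutator subgroup the abelianized Fox derivatives are additive, so
    they cannot distinguish [u * v] from [v * u]. *)
Lemma ab_fox_commg j (u v : F) : to_ab u = 1%g -> to_ab v = 1%g ->
  ab_ring (fox j (of_group [~ u, v]%g)) = 0.
Proof.
move=> u1 v1; have := ab_foxM j (v * u)%g [~ u, v]%g.
rewrite -commgC !ab_foxM gmulfM /= u1 v1 mulg1 of_group1 !mul1r addrC => /eqP.
by rewrite -subr_eq0 opprD addrA subrr add0r oppr_eq0 => /eqP.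
Qed.

(** Conjugation by an element of the second derived subgroup is in the Magnus
    kernel; single commutators of elements of the derived subgroup suffice for
    the sequel. *)
Lemma inner_commg_kernel (u v : F) : to_ab u = 1%g -> to_ab v = 1%g ->
  {s : magnus_kernel n | aut_fun (val (val s)) =1 conjg^~ [~ u, v]%g}.
Proof.
move=> u1 v1; pose g := [~ u, v]%g.
have IA_g : kernel_pred (@aut_ab F) (inner_aut g).
  apply/eqP/aut_ext => h; rewrite -(to_ab_surj h) aut_abE.
  exact: to_ab_conjg.
pose s : IA n := exist _ (inner_aut g) IA_g.
have K_s : kernel_pred (@magnus n) s.
  apply/eqP/val_inj/matrixP => i j; rewrite !mxE /=.
  (* Differentiate both sides of g * (gen i ^ g) = gen i * g. *)
  have := ab_foxM j g (gen i ^ g)%g.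
  rewrite -conjgC ab_foxM ab_fox_commg // to_ab_commg of_group1 !mul1r.
  rewrite mulr0 addr0 add0r => <-.
  exact: ab_fox_gen.
by exists (exist _ s K_s).
Qed.

End InnerAutomorphisms.

(** * The universal property of the free group *)

Section FreeExtension.
Local Open Scope group_scope.
Variables (n : nat) (G : groupType) (f : 'I_n -> G).
Local Notation F := (free_group n).

Definition letter_ext (a : letter n) : G := if a.2 then (f a.1)^-1 else f a.1.

Definition free_ext (w : F) : G := \prod_(a <- val w) letter_ext a.

Lemma letter_extV a : letter_ext (letter_inv a) = (letter_ext a)^-1.
Proof. by case: a => i []; rewrite /letter_ext /= ?invgK. Qed.

Lemma prod_push a w : \prod_(b <- push a w) letter_ext b =
  letter_ext a * \prod_(b <- w) letter_ext b.
Proof.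
case: w => [|b w] /=; first by rewrite big_cons.
case: eqP => [->|_]; last by rewrite big_cons.
by rewrite big_cons letter_extV mulVKg.
Qed.

Fact free_ext_monoid_morphism : monoid.monoid_morphism free_ext.
Proof.
split=> [|u v]; first by rewrite /free_ext big_nil.
have E : val (u * v) = foldr (@push n) (val v) (val u) := fg_mulE u v.
rewrite /free_ext E; elim: (val u) => [|a w IHw]; first by rewrite big_nil mul1g.
by rewrite /= prod_push IHw big_cons mulgA.
Qed.
HB.instance Definition _ :=
  isUMagmaMorphism.Build F G free_ext free_ext_monoid_morphism.

Lemma free_ext_gen i : free_ext (gen i) = f i.
Proof. by rewrite /free_ext /= big_seq1. Qed.

End FreeExtension.

(** * Triangular representations of degree three *)

(** Turns a linear equation known to hold into a proof of another one that
    differs from it by a ring identity. *)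
Lemma eq_of_subr (V : zmodType) (a b x y : V) :
  x = y -> (a - b = x - y -> a = b)%R.
Proof. by move=> ->; rewrite subrr; apply: subr0_eq. Qed.

Section TriangularRepresentations.
Local Open Scope ring_scope.
Variables (n : nat) (K : fieldType).
Local Notation F := (free_group n).
Variable rho : gmorphism F (general_linear 3 K).

(** Indices are natural numbers so that the entries can be named by numerals and
    sums over them expand by computation. *)
Definition entry (i j : nat) (w : F) : K := val (rho w) (inord i) (inord j).

Definition triangular := forall i j w, (j < i < 3)%N -> entry i j w = 0.

Lemma entryM i j u v : entry i j (u * v)%g =
  entry i 0 u * entry 0 j v + entry i 1 u * entry 1 j v
    + entry i 2 u * entry 2 j v.
Proof.
rewrite /entry gmulfM /= mxE.
pose term k := val (rho u) (inord i) (inord k) * val (rho v) (inord k) (inord j).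
transitivity (\sum_(0 <= k < 3) term k).
  by rewrite big_mkord; apply: eq_bigr => k _; rewrite /term inord_val.
by rewrite !big_nat_recr //= big_geq ?add0r.
Qed.

Lemma entry1 i j : (i < 3)%N -> (j < 3)%N -> entry i j 1%g = (i == j)%:R.
Proof.
move=> i3 j3; rewrite /entry gmulf1 /=.
by rewrite mxE -val_eqE /= !inordK.
Qed.

Hypothesis rhoT : triangular.

Lemma diagonal_character i : (i < 3)%N -> character (entry i i).
Proof.
by case: i => [|[|[|]]] // _; split=> [|u v];
  rewrite ?entry1 // entryM ?(@rhoT 1 0) ?(@rhoT 2 0) ?(@rhoT 2 1) //; ring.
Qed.

Lemma superdiagonal_derivation i : (i < 2)%N ->
  derivation (entry i i) (entry i.+1 i.+1) (entry i i.+1).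
Proof.
by case: i => [|[|]] // _ u v;
  rewrite entryM ?(@rhoT 1 0) ?(@rhoT 2 0) ?(@rhoT 2 1) //; ring.
Qed.

Lemma cornerM u v : entry 0 2 (u * v)%g =
  entry 0 0 u * entry 0 2 v + entry 0 1 u * entry 1 2 v
    + entry 0 2 u * entry 2 2 v.
Proof. exact: entryM. Qed.

Lemma diagonal_eq1 i u : (i < 3)%N -> to_ab u = 1%g -> entry i i u = 1.
Proof.
move=> i3 u1; rewrite (character_to_ab (v := 1%g) (diagonal_character i3)) //.
by rewrite entry1 // eqxx.
Qed.

Definition corner_shift (s : magnus_kernel n) (w : F) : K :=
  entry 0 2 (aut_fun (val (val s)) w) - entry 0 2 w.

(** The failure of the corner entry to be a derivation is a product of two
    derivations, which [s] leaves unchanged, so it cancels in the difference. *)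
Lemma corner_shift_derivation s :
  derivation (entry 0 0) (entry 2 2) (corner_shift s).
Proof.
move=> u v; rewrite /corner_shift autM !cornerM.
have b_s := @magnus_kernel_derivation _ _ _ _ _ s
  (@diagonal_character 0 isT) (@diagonal_character 1 isT)
  (@superdiagonal_derivation 0 isT).
have f_s := @magnus_kernel_derivation _ _ _ _ _ s
  (@diagonal_character 1 isT) (@diagonal_character 2 isT)
  (@superdiagonal_derivation 1 isT).
rewrite b_s f_s.
rewrite (character_to_ab (@diagonal_character 0 isT) (magnus_kernel_to_ab s u)).
rewrite (character_to_ab (@diagonal_character 2 isT) (magnus_kernel_to_ab s v)).
ring.
Qed.

(** The shift by [t], being a derivation, is not affected by applying [s] first. *)
Lemma corner_shiftM s t w :
  corner_shift (s * t)%g w = corner_shift s w + corner_shift t w.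
Proof.
have := magnus_kernel_derivation s (@diagonal_character 0 isT)
  (@diagonal_character 2 isT) (corner_shift_derivation t) w.
rewrite /corner_shift /= => <-; ring.
Qed.

Lemma superdiagonal_commg i u v : (i < 2)%N ->
  to_ab u = 1%g -> to_ab v = 1%g -> entry i i.+1 [~ u, v]%g = 0.
Proof.
move=> i2 u1 v1; have dM := superdiagonal_derivation i2.
have i3 : (i < 3)%N by apply: ltnW.
have vu1 : to_ab (v * u)%g = 1%g by rewrite gmulfM /= u1 v1 mulg1.
have := commgC u v; have := to_ab_commg u v; move: [~ u, v]%g => w w1 E.
have := dM (v * u)%g w; rewrite -E !dM !diagonal_eq1 // => dE.
apply: (eq_of_subr (esym dE)); ring.
Qed.

(** On the derived subgroup the representation is unipotent, that is, takes values
    in a Heisenberg group, where commutators are given by this alternating form. *)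
Lemma corner_commg u v : to_ab u = 1%g -> to_ab v = 1%g ->
  entry 0 2 [~ u, v]%g = entry 0 1 u * entry 1 2 v - entry 0 1 v * entry 1 2 u.
Proof.
move=> u1 v1; have f0 := @superdiagonal_commg 1 u v isT u1 v1.
have vu1 : to_ab (v * u)%g = 1%g by rewrite gmulfM /= u1 v1 mulg1.
have := commgC u v; have := to_ab_commg u v.
move: [~ u, v]%g f0 => w f0 w1 E.
have := cornerM (v * u)%g w; rewrite -E !cornerM f0 !diagonal_eq1 // => qE.
apply: (eq_of_subr (esym qE)); ring.
Qed.

(** Off the diagonal, the unipotent image of [g] is zero except in the corner;
    conjugating by it changes the corner by the difference of the outer diagonal
    characters. *)
Lemma corner_shift_inner (s : magnus_kernel n) g w : to_ab g = 1%g ->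
  entry 0 1 g = 0 -> entry 1 2 g = 0 -> aut_fun (val (val s)) =1 conjg^~ g ->
  corner_shift s w = entry 0 2 g * (entry 0 0 w - entry 2 2 w).
Proof.
move=> g1 b0 f0 sg; rewrite /corner_shift sg.
have := cornerM g (w ^ g)%g; rewrite -conjgC (cornerM w g).
rewrite b0 f0 (@diagonal_eq1 0 g isT g1) (@diagonal_eq1 2 g isT g1).
rewrite (character_to_ab (@diagonal_character 2 isT) (to_ab_conjg w g)).
move=> qE; apply: (eq_of_subr (esym qE)); ring.
Qed.

End TriangularRepresentations.

(** * A triangular representation with unbounded denominators *)

Section UpperTriangularMatrices.
Local Open Scope ring_scope.
Variables (n : nat) (R : nzRingType).

Definition upper (A : 'M[R]_n) := forall i j : 'I_n, (j < i)%N -> A i j = 0.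

Lemma upper1 : upper 1%:M.
Proof. by move=> i j ji; rewrite mxE -val_eqE gtn_eqF. Qed.

Lemma upperM A B : upper A -> upper B -> upper (A *m B).
Proof.
move=> uA uB i j ji; rewrite mxE big1 // => k _.
have [ki|ik] := ltnP k i; first by rewrite uA ?mul0r.
by rewrite uB ?mulr0 // (leq_trans ji).
Qed.

Lemma gl_invE (A : general_linear n R) B :
  val A *m B = 1%:M -> val A^-1%g = B.
Proof.
move=> AB; have /(congr1 val) A'A := mulVg A.
by rewrite -[LHS]mulmx1 -AB mulmxA (_ : val _ *m val A = 1%:M) ?mul1mx.
Qed.

End UpperTriangularMatrices.

Section Witness.
Local Open Scope ring_scope.

Definition mx3 (s : seq (seq rat)) : 'M[rat]_3 :=
  \matrix_(i, j) (nth [::] s i)`_j.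

(** Conjugation by this diagonal matrix multiplies the superdiagonal entries of a
    unipotent matrix by 1 / 2 and -1. With equal factors the alternating form of
    [corner_commg] would vanish on the conjugates of a single commutator, and
    with both factors in {1, -1} no denominators would appear. The outer
    diagonal entries must differ for [corner_shift_inner] to be nonzero. *)
Definition stretch :=
  [:: [:: 2; 0; 0]; [:: 0; 1; 0]; [:: 0; 0; -1]] : seq (seq rat).
Definition stretch_inv :=
  [:: [:: 1 / 2; 0; 0]; [:: 0; 1; 0]; [:: 0; 0; -1]] : seq (seq rat).
Definition shear := [:: [:: 1; 1; 0]; [:: 0; 1; 1]; [:: 0; 0; 1]] : seq (seq rat).
Definition shear_inv :=
  [:: [:: 1; -1; 1]; [:: 0; 1; -1]; [:: 0; 0; 1]] : seq (seq rat).

Fact mx3_inverses :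
  [/\ mx3 stretch *m mx3 stretch_inv = 1%:M,
      mx3 stretch_inv *m mx3 stretch = 1%:M,
      mx3 shear *m mx3 shear_inv = 1%:M
    & mx3 shear_inv *m mx3 shear = 1%:M].
Proof.
split; apply/matrixP => i j; rewrite !mxE !big_ord_recl big_ord0 !mxE;
  by case: i => [[|[|[|]]]] //= ?; case: j => [[|[|[|]]]].
Qed.

Fact mx3_upper :
  [/\ upper (mx3 stretch), upper (mx3 stretch_inv),
      upper (mx3 shear) & upper (mx3 shear_inv)].
Proof.
by split=> -[[|[|[|]]] ?] // [[|[|[|]]] ?] //; rewrite mxE.
Qed.

Fact stretch_GL : GL_pred (mx3 stretch).
Proof. by apply/asboolP; exists (mx3 stretch_inv); case: mx3_inverses. Qed.

Fact shear_GL : GL_pred (mx3 shear).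
Proof. by apply/asboolP; exists (mx3 shear_inv); case: mx3_inverses. Qed.

Let gl_stretch : general_linear 3 rat := exist _ (mx3 stretch) stretch_GL.
Let gl_shear : general_linear 3 rat := exist _ (mx3 shear) shear_GL.

Variables (n : nat) (a b : 'I_n).
Hypothesis ab : a != b.

Definition witness_gen (i : 'I_n) : general_linear 3 rat :=
  if i == a then gl_stretch else if i == b then gl_shear else 1%g.

Definition witness : gmorphism (free_group n) (general_linear 3 rat) :=
  free_ext witness_gen.

Lemma witness_upper w : upper (val (witness w)).
Proof.
rewrite /witness /= /free_ext.
have [uS uSi uH uHi] := mx3_upper; have [SS' _ HH' _] := mx3_inverses.
apply: (@big_ind _ (fun g : general_linear 3 rat => upper (val g))).
- exact: upper1.
- by move=> g h; apply: upperM.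
case=> i [] _; rewrite /letter_ext /witness_gen /=.
  case: eqP => _; first by rewrite (@gl_invE _ _ gl_stretch _ SS').
  case: eqP => _; first by rewrite (@gl_invE _ _ gl_shear _ HH').
  by rewrite invg1; apply: upper1.
by case: eqP => _ //; case: eqP => _ //; apply: upper1.
Qed.

Lemma witness_triangular : triangular witness.
Proof.
move=> i j w /andP[ji i3]; apply: witness_upper.
by rewrite !inordK // (ltn_trans ji).
Qed.

Lemma entry_a i j : (i < 3)%N -> (j < 3)%N ->
  entry witness i j (gen a) = (nth [::] stretch i)`_j.
Proof.
move=> i3 j3; rewrite /entry /witness /= free_ext_gen /witness_gen eqxx.
by rewrite mxE !inordK.
Qed.

Lemma entry_b i j : (i < 3)%N -> (j < 3)%N ->
  entry witness i j (gen b) = (nth [::] shear i)`_j.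
Proof.
move=> i3 j3; rewrite /entry /witness /= free_ext_gen /witness_gen.
by rewrite eq_sym (negbTE ab) eqxx mxE !inordK.
Qed.

(** Read off from gen a * gen b = gen b * gen a * [~ gen a, gen b]. *)
Lemma superdiagonal_ab :
  entry witness 0 1 [~ gen a, gen b]%g = 1 / 2
  /\ entry witness 1 2 [~ gen a, gen b]%g = 2.
Proof.
have b_M := superdiagonal_derivation witness_triangular (isT : 0 < 2)%N.
have f_M := superdiagonal_derivation witness_triangular (isT : 1 < 2)%N.
have [_ e0M] := diagonal_character witness_triangular (isT : 0 < 3)%N.
have [_ e1M] := diagonal_character witness_triangular (isT : 1 < 3)%N.
have w1 := to_ab_commg (gen a) (gen b).
have w2 := diagonal_eq1 witness_triangular (isT : 2 < 3)%N w1.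
have w11 := diagonal_eq1 witness_triangular (isT : 1 < 3)%N w1.
have := commgC (gen a) (gen b); move: [~ _, _]%g w1 w2 w11 => w w1 w2 w11 E.
have := b_M (gen b * gen a)%g w; have := f_M (gen b * gen a)%g w.
rewrite -E !b_M !f_M e0M e1M w2 w11 !entry_a // !entry_b //= => fE bE.
by split; lra.
Qed.

(** Each step is read off from v * gen a = gen a * (v ^ gen a). *)
Lemma superdiagonal_conj_iter k :
  let v := iter k (conjg^~ (gen a)) [~ gen a, gen b]%g in
  [/\ to_ab v = 1%g, entry witness 0 1 v = 1 / 2 / 2 ^+ k
    & entry witness 1 2 v = 2 * (-1) ^+ k].
Proof.
have [b0 f0] := superdiagonal_ab.
elim: k => [|k [v1 bv fv]] /=; first by rewrite to_ab_commg b0 f0 divr1 mulr1.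
move: (iter _ _ _) v1 bv fv => v v1 bv fv; rewrite to_ab_conjg v1; split=> //.
  have bM := superdiagonal_derivation witness_triangular (isT : 0 < 2)%N.
  have := bM (gen a) (v ^ gen a)%g; rewrite -conjgC (bM v) bv !entry_a //= => E.
  apply: (@mulfI _ 2) => //; apply: (eq_of_subr (esym E)).
  by rewrite exprS; field; rewrite expf_neq0.
have fM := superdiagonal_derivation witness_triangular (isT : 1 < 2)%N.
have := fM (gen a) (v ^ gen a)%g; rewrite -conjgC (fM v) fv !entry_a //= => E.
apply: (eq_of_subr (esym E)); rewrite exprS; ring.
Qed.

(** The automorphism is conjugation by [[u, v]] with [u = [~ gen a, gen b]] and [v]
    the conjugate of [u] by the [k]-th power of [gen a]. *)
Lemma corner_shift_unbounded k : exists s : magnus_kernel n,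
  corner_shift witness s (gen a) = 3 * (-1) ^+ k - 3 / 2 ^+ k.
Proof.
have w1 := to_ab_commg (gen a) (gen b).
have [b0 f0] := superdiagonal_ab.
have [v1 bv fv] := superdiagonal_conj_iter k.
move: (iter k _ _) v1 bv fv => v v1 bv fv.
have [s sE] := inner_commg_kernel w1 v1; exists s.
rewrite (corner_shift_inner witness_triangular _ _ _ _ sE); last 3 first.
- exact: to_ab_commg.
- exact: (superdiagonal_commg witness_triangular (isT : 0 < 2)%N).
- exact: (superdiagonal_commg witness_triangular (isT : 1 < 2)%N).
rewrite (corner_commg witness_triangular) // b0 f0 bv fv !entry_a //=.
by field; rewrite expf_neq0.
Qed.

End Witness.

(** The part [3 * (-1) ^ k] is integral, so integrality would force [3 * d / 2 ^ k]
    to be an integer for all [k], but it is eventually strictly between 0 and 1. *)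
Lemma three_div_expn2_not_int (d : int) : (0 < d ->
  ~ forall k, d%:~R * (3 * (-1) ^+ k - 3 / 2 ^+ k) \is a @Num.int rat)%R.
Proof.
(* Any k with 3 * d < 2 ^ k would do; k = 3 * d is one. *)
move=> d0 /(_ (absz (d * 3)%R)); set k := absz _ => H.
have k_eq : ((k%:R : rat) = d%:~R * 3)%R.
  by rewrite -[3%R]/(3%:~R)%R -intrM pmulrn /k gez0_abs // mulr_ge0 // ltW.
have p0 : (0 < 2 ^+ k :> rat)%R by rewrite exprn_gt0.
have kp : (k%:R < 2 ^+ k :> rat)%R by rewrite -natrX ltr_nat ltn_expl.
have k0 : (0 < k%:R :> rat)%R by rewrite k_eq mulr_gt0 // ltr0z.
have : (k%:R / 2 ^+ k \is a @Num.int rat)%R.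
  have -> : (k%:R / 2 ^+ k = d%:~R * 3 * (-1) ^+ k
     - d%:~R * (3 * (-1) ^+ k - 3 / 2 ^+ k) :> rat)%R.
    by rewrite k_eq; field; rewrite gt_eqF.
  by rewrite rpredB // !rpredM ?rpredX ?rpredN ?rpred1 ?intr_int.
case/intrP => m mE.
have : (0 < (m%:~R : rat) < 1)%R.
  by rewrite -mE divr_gt0 //= ltr_pdivrMr // mul1r.
by rewrite ltr0z ltrz1; lia.
Qed.

Theorem theorem1 (n : nat) (n_ge2 : (2 <= n)%N) :
  ~ finitely_generated (abelianization (magnus_kernel n)).
Proof.
pose a : 'I_n := Ordinal (ltnW n_ge2); pose b : 'I_n := Ordinal n_ge2.
have ab : a != b by [].
have shiftM s t := corner_shiftM (witness_triangular a b) s t (gen a).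
move=> /(fg_abelianization_bounded_denominators shiftM)[d d_gt0 d_int].
apply: (three_div_expn2_not_int d_gt0) => k.
by have [s <-] := corner_shift_unbounded ab k.
Qed.
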